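(* Let $M$ be the monoid presented by $\langle a,b,c\mid ac=ca,\ bc=cb,\ cab=cbb\rangle$. Then: (1) every element of $M$ is represented by exactly one word in the set $\{a,b\}^*\cup c^+b^*a^*$; (2) $M$ is biautomatic and hence automatic; (3) $M$ does not have finite derivation type, and hence is not FCRS.
   Context: A monoid is FCRS if it admits a presentation by a finite complete (noetherian and confluent) string rewriting system over some finite generating set. FDT (finite derivation type, Squier): some (equivalently any) finite presentation has a derivation graph with a finite homotopy base (derivation graph: vertices are words, edges are single applications $x\ell y\leftrightarrow xry$ of defining relations; homotopy relation generated by a set of pairs of parallel paths is the smallest equivalence on paths contained in parallelism, closed under two-sided multiplication by words and under composition on either side, identifying $\mathbb{P}\circ\mathbb{P}^{-1}$ with the empty path and identifying the two orders of applying two disjoint rewrites; a homotopy base is a set generating all of parallelism). Automatic/biautomatic: for a finite generating alphabet $A$ and regular $L\subseteq A^*$ mapping onto $M$, with $L_a=\{(u,v)\in L^2: ua=_Mv\}$, ${}_aL=\{(u,v)\in L^2: au=_Mv\}$, and $\delta_R$ ($\delta_L$) padding the shorter word at the end (beginning) with $\$$: automatic if all $L_a\delta_R$ regular; biautomatic if all $L_a\delta_R,{}_aL\delta_R,L_a\delta_L,{}_aL\delta_L$ regular, for some such $(A,L)$. *)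

(* Defs.v *)
From HB Require Import structures.
From Stdlib Require Import Relations.
From Stdlib Require List.
From mathcomp Require Import all_boot.
Set Implicit Arguments. Unset Strict Implicit. Unset Printing Implicit Defensive.

Definition pres (B : Type) := seq (seq B * seq B).

Definition step (B : Type) (R : pres B) (u v : seq B) : Prop :=
  exists x l r y, List.In (l, r) R /\ u = x ++ l ++ y /\ v = x ++ r ++ y.

Definition cong (B : Type) (R : pres B) : seq B -> seq B -> Prop :=
  clos_refl_sym_trans (seq B) (step R).

Definition ext (B C : Type) (f : B -> seq C) (w : seq B) : seq C :=
  flatten (map f w).

(* The finite presentation <B | R> presents the same monoid as <A0 | R0>:
   phi induces a monoid isomorphism <B | R> -> <A0 | R0>
   (well defined and injective: the iff; surjective: every generator of
   A0 is hit by the image of psi). *)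
Definition presents (B A0 : finType) (R : pres B) (R0 : pres A0) : Prop :=
  exists (phi : B -> seq A0) (psi : A0 -> seq B),
    (forall u v : seq B, cong R u v <-> cong R0 (ext phi u) (ext phi v)) /\
    (forall x : A0, cong R0 (ext phi (ext psi [:: x])) [:: x]).

Record dfa (X : Type) := DFA {
  dstate : finType;
  dinit : dstate;
  dfinal : pred dstate;
  dtrans : dstate -> X -> dstate }.

Definition accepts (X : Type) (D : dfa X) (s : seq X) : bool :=
  @dfinal X D (foldl (@dtrans X D) (@dinit X D) s).

Definition regular (X : Type) (P : seq X -> Prop) : Prop :=
  exists D : dfa X, forall s, accepts D s <-> P s.

Definition padR (A : Type) (u v : seq A) : seq (option A * option A) :=
  let n := maxn (size u) (size v) in
  zip (map Some u ++ nseq (n - size u) None) (map Some v ++ nseq (n - size v) None).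

Definition padL (A : Type) (u v : seq A) : seq (option A * option A) :=
  let n := maxn (size u) (size v) in
  zip (nseq (n - size u) None ++ map Some u) (nseq (n - size v) None ++ map Some v).

Definition padded (A : Type) (pad : seq A -> seq A -> seq (option A * option A))
  (Rel : seq A -> seq A -> Prop) : seq (option A * option A) -> Prop :=
  fun s => exists u v, Rel u v /\ s = pad u v.

Section Automatic.
Variables (A0 : finType) (R0 : pres A0).
Variables (A : finType) (gen : A -> seq A0) (L : seq A -> Prop).

(* L is regular and maps onto M = <A0 | R0> (gen a is a word representing
   the element of M named by the letter a) *)
Definition rep_lang : Prop :=
  regular L /\ forall w : seq A0, exists u, L u /\ cong R0 (ext gen u) w.

Definition Lright (a : A) (u v : seq A) : Prop :=
  L u /\ L v /\ cong R0 (ext gen (u ++ [:: a])) (ext gen v).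
Definition Lleft (a : A) (u v : seq A) : Prop :=
  L u /\ L v /\ cong R0 (ext gen (a :: u)) (ext gen v).
End Automatic.

Definition automatic (A0 : finType) (R0 : pres A0) : Prop :=
  exists (A : finType) (gen : A -> seq A0) (L : seq A -> Prop),
    rep_lang R0 gen L /\
    forall a : A, regular (padded (@padR A) (Lright R0 gen L a)).

Definition biautomatic (A0 : finType) (R0 : pres A0) : Prop :=
  exists (A : finType) (gen : A -> seq A0) (L : seq A -> Prop),
    rep_lang R0 gen L /\
    forall a : A,
      [/\ regular (padded (@padR A) (Lright R0 gen L a)),
          regular (padded (@padR A) (Lleft R0 gen L a)),
          regular (padded (@padL A) (Lright R0 gen L a)) &
          regular (padded (@padL A) (Lleft R0 gen L a))].

Definition noetherian (B : Type) (R : pres B) : Prop :=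
  ~ exists f : nat -> seq B, forall n, step R (f n) (f n.+1).

Definition confluent (B : Type) (R : pres B) : Prop :=
  forall u v w, clos_refl_trans _ (step R) u v -> clos_refl_trans _ (step R) u w ->
    exists z, clos_refl_trans _ (step R) v z /\ clos_refl_trans _ (step R) w z.

Definition FCRS (A0 : finType) (R0 : pres A0) : Prop :=
  exists (B : finType) (R : pres B), presents R R0 /\ noetherian R /\ confluent R.

Section Derivation.
Variable B : Type.

(* edge  x.(l or r).y -> x.(r or l).y ; edir = true means l -> r *)
Record edge := Edge {
  eleft : seq B; erule : seq B * seq B; eright : seq B; edir : bool }.

Definition rsrc (rho : seq B * seq B) (d : bool) := if d then rho.1 else rho.2.
Definition rtgt (rho : seq B * seq B) (d : bool) := if d then rho.2 else rho.1.

Definition esrc (e : edge) := eleft e ++ rsrc (erule e) (edir e) ++ eright e.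
Definition etgt (e : edge) := eleft e ++ rtgt (erule e) (edir e) ++ eright e.

Definition edge_ok (R : pres B) (e : edge) : Prop := List.In (erule e) R.

(* a path: its source vertex and its list of edges *)
Definition path := (seq B * seq edge)%type.

Fixpoint chain (R : pres B) (w : seq B) (es : seq edge) : Prop :=
  match es with
  | [::] => True
  | e :: es' => edge_ok R e /\ esrc e = w /\ chain R (etgt e) es'
  end.

Definition valid (R : pres B) (p : path) : Prop := chain R p.1 p.2.
Definition ptgt (p : path) : seq B := last p.1 (map etgt p.2).

Definition parallel (R : pres B) (p q : path) : Prop :=
  [/\ valid R p, valid R q, p.1 = q.1 & ptgt p = ptgt q].

Definition comp (p q : path) : path := (p.1, p.2 ++ q.2).
Definition eflip (e : edge) : edge := Edge (eleft e) (erule e) (eright e) (~~ edir e).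
Definition pinv (p : path) : path := (ptgt p, rev (map eflip p.2)).
Definition whisk (x : seq B) (p : path) (y : seq B) : path :=
  (x ++ p.1 ++ y,
   map (fun e => Edge (x ++ eleft e) (erule e) (eright e ++ y) (edir e)) p.2).

Inductive homotopic (R : pres B) (H : path -> path -> Prop) : path -> path -> Prop :=
| hom_base p q : H p q -> homotopic R H p q
| hom_refl p : valid R p -> homotopic R H p p
| hom_sym p q : homotopic R H p q -> homotopic R H q p
| hom_trans p q r : homotopic R H p q -> homotopic R H q r -> homotopic R H p r
| hom_whisk x y p q : homotopic R H p q -> homotopic R H (whisk x p y) (whisk x q y)
| hom_compr p q r : homotopic R H p q -> valid R r -> r.1 = ptgt p ->
    homotopic R H (comp p r) (comp q r)
| hom_compl p q r : homotopic R H p q -> valid R r -> ptgt r = p.1 ->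
    homotopic R H (comp r p) (comp r q)
| hom_inv p : valid R p -> homotopic R H (comp p (pinv p)) (p.1, [::])
| hom_indep rho1 d1 rho2 d2 w : List.In rho1 R -> List.In rho2 R ->
    homotopic R H
      (rsrc rho1 d1 ++ w ++ rsrc rho2 d2,
       [:: Edge [::] rho1 (w ++ rsrc rho2 d2) d1;
           Edge (rtgt rho1 d1 ++ w) rho2 [::] d2])
      (rsrc rho1 d1 ++ w ++ rsrc rho2 d2,
       [:: Edge (rsrc rho1 d1 ++ w) rho2 [::] d2;
           Edge [::] rho1 (w ++ rtgt rho2 d2) d1]).

Definition finite_homotopy_base (R : pres B) : Prop :=
  exists Hs : seq (path * path),
    (forall p q, List.In (p, q) Hs -> parallel R p q) /\
    (forall p q, parallel R p q -> homotopic R (fun p' q' => List.In (p', q') Hs) p q).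
End Derivation.

Definition FDT (A0 : finType) (R0 : pres A0) : Prop :=
  exists (B : finType) (R : pres B), presents R R0 /\ finite_homotopy_base R.

Inductive abc := La | Lb | Lc.

Definition abc_to (x : abc) : 'I_3 :=
  match x with La => @Ordinal 3 0 isT | Lb => @Ordinal 3 1 isT | Lc => @Ordinal 3 2 isT end.
Definition abc_of (i : 'I_3) : abc :=
  match val i with 0 => La | 1 => Lb | _ => Lc end.
Lemma abc_toK : cancel abc_to abc_of. Proof. by case. Qed.
HB.instance Definition _ := Countable.copy abc (can_type abc_toK).
HB.instance Definition _ := Finite.copy abc (can_type abc_toK).

Definition Mrel : pres abc :=
  [:: ([:: La; Lc], [:: Lc; La]);
      ([:: Lb; Lc], [:: Lc; Lb]);
      ([:: Lc; La; Lb], [:: Lc; Lb; Lb])].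

Definition normal_form (u : seq abc) : Prop :=
  all (fun x => x != Lc) u \/
  exists n i j, 0 < n /\ u = nseq n Lc ++ nseq i Lb ++ nseq j La.

(* Main.v *)
Require Import Defs.
From HB Require Import structures.
From Stdlib Require Import Relations.
From Stdlib Require List.
From Stdlib Require Import Classical ClassicalEpsilon.
From mathcomp Require Import all_boot.
Set Implicit Arguments. Unset Strict Implicit. Unset Printing Implicit Defensive.

(** Modulo M the letter c is central and, next to a c, every letter followed
    later by a b becomes a b: a word containing c is determined by its length,
    its number of c's and the number of its trailing a's.

    For biautomaticity take the representatives c^*{a,b}^*: multiplication by a
    generator appends or inserts one letter, so v is compared letter by letter
    with a delayed copy of u, and equality of trailing runs of a's can be
    tracked by one bit.

    For (3), delete the c's and give a step u -> v the weight mod 2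
    [j-th letter of u is b] * [u and v differ in their first letter], j large.
    Consider words with a single c.  Closed paths confined to a window of length
    <= j never see both positions, so they have weight 0; disjoint rewritings do
    not occur, because every nontrivial relation involves c.  Hence a finite
    homotopy base, or the critical pairs of a finite complete system (by
    Newman's induction carrying the weights), force parallel paths in any finite
    presentation of M to have equal weights.  But rewriting the first and the
    last ab of cab b^(j-2) ab in the two possible orders gives different weights.
    Elements of length 1 are alone in their class, so this square lifts to every
    presentation. *)

(** * Congruence of a presentation *)

Notation Mcong := (cong Mrel).

Section Congruence.
Variables (B : Type) (R : pres B).
Implicit Types u v w x y : seq B.

Lemma cong_refl u : cong R u u. Proof. exact: rst_refl. Qed.

Lemma cong_sym u v : cong R u v -> cong R v u.
Proof. exact: rst_sym. Qed.

Lemma cong_trans v u w : cong R u v -> cong R v w -> cong R u w.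
Proof. exact: rst_trans. Qed.

Lemma step_ctx x y u v : step R u v -> step R (x ++ u ++ y) (x ++ v ++ y).
Proof.
move=> [x' [l [r [y' [lr [-> ->]]]]]].
by exists (x ++ x'), l, r, (y' ++ y); rewrite -!catA.
Qed.

Lemma cong_ctx x y u v : cong R u v -> cong R (x ++ u ++ y) (x ++ v ++ y).
Proof.
elim=> {u v} [u v /(step_ctx x y)|u|u v _|u v w _ uv _ vw].
- exact: rst_step.
- exact: cong_refl.
- exact: cong_sym.
- exact: cong_trans uv vw.
Qed.

Lemma cong_catl x u v : cong R u v -> cong R (x ++ u) (x ++ v).
Proof. by move=> /(cong_ctx x [::]); rewrite !cats0. Qed.

Lemma cong_catr y u v : cong R u v -> cong R (u ++ y) (v ++ y).
Proof. exact: (cong_ctx [::] y). Qed.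

Lemma cong_rule l r : List.In (l, r) R -> cong R l r.
Proof.
by move=> lr; apply: rst_step; exists [::], l, r, [::]; rewrite !cats0.
Qed.

Lemma cong_rt_sym u v :
  cong R u v -> clos_refl_trans _ (fun s t => step R s t \/ step R t s) u v.
Proof.
elim=> {u v} [u v uv|u|u v _ vu|u v w _ uv _ vw].
- by apply: rt_step; left.
- exact: rt_refl.
- elim: vu => {u v} [u v []uv|u|u v w _ uv _ vw].
  + by apply: rt_step; right.
  + by apply: rt_step; left.
  + exact: rt_refl.
  + exact: rt_trans vw uv.
- exact: rt_trans uv vw.
Qed.

Lemma rt_step_cong u v : clos_refl_trans _ (step R) u v -> cong R u v.
Proof.
elim=> {u v} [u v uv|u|u v w _ uv _ vw].
- exact: rst_step.
- exact: cong_refl.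
- exact: cong_trans uv vw.
Qed.

Lemma ext_cat (C : Type) (f : B -> seq C) u v : ext f (u ++ v) = ext f u ++ ext f v.
Proof. by rewrite /ext map_cat flatten_cat. Qed.

Lemma ext_seq1 (C : Type) (f : B -> seq C) (x : B) : ext f [:: x] = f x.
Proof. exact: cats0. Qed.

End Congruence.

(** * Invariants and normal forms of M *)

Definition nbc (w : seq abc) := count_mem Lc w.
Definition del_c (w : seq abc) := [seq x <- w | x != Lc].
Definition trail_step (n : nat) (x : abc) :=
  match x with La => n.+1 | Lb => 0 | Lc => n end.
Definition trail (w : seq abc) := foldl trail_step 0 w.

Lemma nbc_cat u v : nbc (u ++ v) = nbc u + nbc v.
Proof. exact: count_cat. Qed.

Lemma del_c_cat u v : del_c (u ++ v) = del_c u ++ del_c v.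
Proof. exact: filter_cat. Qed.

Lemma size_del_c w : size (del_c w) = size w - nbc w.
Proof. by rewrite size_filter -(count_predC (pred1 Lc) w) addKn. Qed.

Lemma Lc_in_nbc w : (Lc \in w) = (0 < nbc w).
Proof. by rewrite -has_pred1 has_count. Qed.

(** The [trail] folds are compared from every starting value, so that the equality can be used
    behind an arbitrary left context. *)
Lemma Mrel_inv l r : List.In (l, r) Mrel ->
  [/\ nbc l = 1, nbc r = 1, size l = size r &
      foldl trail_step ^~ l =1 foldl trail_step ^~ r].
Proof. by case=> [[<- <-]|[[<- <-]|[[<- <-]|[]]]]. Qed.

Lemma Mstep_inv u v : step Mrel u v ->
  [/\ size u = size v, nbc u = nbc v, trail u = trail v & 0 < nbc u].
Proof.
move=> [x [l [r [y [/Mrel_inv [nl nr slr tlr] [-> ->]]]]]].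
rewrite /trail !foldl_cat -tlr !size_cat slr !nbc_cat nl nr; split=> //.
by rewrite addnCA.
Qed.

(** Both sides of every relation contain a c, so no relation applies to a word without c and such a
    word is alone in its class. *)
Lemma Mcong_inv u v : Mcong u v ->
  [/\ size u = size v, nbc u = nbc v, trail u = trail v & nbc u = 0 -> u = v].
Proof.
elim=> {u v} [u v /Mstep_inv|//|u v _ [-> -> -> uv]|u v w _ [-> -> -> uv] _ [-> -> -> vw]].
- by move=> [? ? ?] n_gt0; split=> // n0; rewrite n0 in n_gt0.
- by split=> // /uv.
- by split=> // w0; rewrite uv // vw.
Qed.

Lemma Mcong_size_del_c u v : Mcong u v -> size (del_c u) = size (del_c v).
Proof. by rewrite !size_del_c => /Mcong_inv [-> ->]. Qed.

Definition nf (w : seq abc) : seq abc :=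
  if Lc \in w
  then nseq (nbc w) Lc ++ nseq (size (del_c w) - trail w) Lb ++ nseq (trail w) La
  else w.

Lemma nf_Mcong u v : Mcong u v -> nf u = nf v.
Proof.
move=> uv; have [_ nuv tuv inj] := Mcong_inv uv.
rewrite /nf !Lc_in_nbc nuv tuv (Mcong_size_del_c uv).
by case: (posnP (nbc v)) => // n0; apply: inj; rewrite nuv.
Qed.

Lemma nf_normal w : normal_form (nf w).
Proof.
rewrite /nf; case: ifPn => [|cw].
  by rewrite Lc_in_nbc => n_gt0; right; do 3!eexists; split; first exact: n_gt0.
by left; apply/allP => x xw; apply: contraNneq cw => <-.
Qed.

Lemma normal_nf w : normal_form w -> nf w = w.
Proof.
case=> [/allP wc|[n [i [j [n_gt0 ->]]]]]; rewrite /nf.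
  by case: ifPn => // /wc; rewrite eqxx.
have trailE m k x : foldl trail_step m (nseq k x) =
    match x with La => m + k | Lb => if k is 0 then m else 0 | Lc => m end.
  elim: k m => [|k IH] m /=; first by case: x; rewrite ?addn0.
  by rewrite IH; case: x {IH} => //=; rewrite ?addSnnS //; case: k.
rewrite Lc_in_nbc size_del_c /trail !foldl_cat !trailE !nbc_cat /nbc !count_nseq /=.
rewrite !mul0n !mul1n !addn0 n_gt0 !size_cat !size_nseq addKn.
have -> : (if i is 0 then 0 else 0) = 0 by case: i.
by rewrite add0n addnK.
Qed.

Lemma c_central w : Mcong (Lc :: w) (rcons w Lc).
Proof.
elim: w => [|x w IH]; first exact: cong_refl.
apply: (@cong_trans _ _ (x :: Lc :: w)); last exact: (cong_catl [:: x] IH).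
apply: (cong_catr w (_ : Mcong [:: Lc; x] [:: x; Lc])).
case: x; [| |exact: cong_refl].
  by apply/cong_sym/cong_rule; left.
by apply/cong_sym/cong_rule; right; left.
Qed.

Lemma c_cat_comm u v : Mcong (Lc :: u ++ v) (u ++ Lc :: v).
Proof. by rewrite -cat_rcons -cat_cons; apply/cong_catr/c_central. Qed.

Lemma c_ab_bb w y : Mcong (Lc :: w ++ [:: La, Lb & y]) (Lc :: w ++ [:: Lb, Lb & y]).
Proof.
apply: cong_trans (c_cat_comm _ _) _; apply: cong_trans (cong_sym (c_cat_comm _ _)).
apply: (cong_ctx w y (_ : Mcong [:: Lc; La; Lb] [:: Lc; Lb; Lb])).
by apply: cong_rule; do 2!right; left.
Qed.

(** The final b turns the a's before it into b's one at a time, from right to left. *)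
Lemma c_nseq_a_b j w :
  Mcong (Lc :: w ++ nseq j La ++ [:: Lb]) (Lc :: w ++ nseq j.+1 Lb).
Proof.
elim: j w => [|j IH] w; first exact: cong_refl.
have -> : nseq j.+1 La ++ [:: Lb] = nseq j La ++ [:: La; Lb].
  by rewrite -addn1 nseqD -catA.
rewrite catA; apply: cong_trans (c_ab_bb _ _) _; rewrite -catA.
have -> : nseq j La ++ [:: Lb; Lb] = (nseq j La ++ [:: Lb]) ++ [:: Lb] by rewrite -catA.
rewrite catA; apply: cong_trans (cong_catr [:: Lb] (IH w)) _.
rewrite cat_cons -catA -[nseq j.+1 Lb ++ _]/(nseq j.+1 Lb ++ nseq 1 Lb) -nseqD addn1.
exact: cong_refl.
Qed.

Lemma trail_le w : trail w <= size (del_c w).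
Proof.
elim/last_ind: w => // w x; rewrite /trail -cats1 del_c_cat size_cat foldl_cat /=.
by case: x => //=; rewrite ?addn0 ?addn1.
Qed.

(** Induction on the last letter: an a lengthens the trailing run, a b absorbs the whole run by
    [c_nseq_a_b], and a c is deleted. *)
Lemma Mcong_c_nf w : Mcong (Lc :: del_c w)
  (Lc :: nseq (size (del_c w) - trail w) Lb ++ nseq (trail w) La).
Proof.
elim/last_ind: w => [|w x IH]; first exact: cong_refl.
have le := trail_le w; move: IH le; rewrite /trail -cats1 del_c_cat foldl_cat /=.
rewrite -/(trail w) size_cat; move: (del_c w) (trail w) => d t IH le.
case: x => /=; rewrite ?cats0 ?addn0 ?addn1 ?subSS ?subn0 ?cats0 //.
  have -> : La :: nseq t La = nseq t La ++ [:: La].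
    by rewrite -[[:: La]]/(nseq 1 La) -nseqD addn1.
  by move/(cong_catr [:: La]): IH; rewrite /= -catA.
move/(cong_catr [:: Lb]): IH; rewrite /= -!catA => IH.
apply: cong_trans IH _; apply: cong_trans (c_nseq_a_b _ _) _.
rewrite -nseqD addnS subnK //; exact: cong_refl.
Qed.

Lemma Mcong_c_del w : Mcong w (nseq (nbc w) Lc ++ del_c w).
Proof.
elim: w => [|x w IH]; first exact: cong_refl.
apply: (cong_trans (cong_catl [:: x] IH)).
have [->|xc] := eqVneq x Lc; first exact: cong_refl.
rewrite /nbc /del_c /= (negbTE xc) add0n /= -/(nbc w) -/(del_c w).
elim: (nbc w) => [|n IHn]; first exact: cong_refl.
apply: (@cong_trans _ _ (Lc :: x :: nseq n Lc ++ del_c w)); last exact: (cong_catl [:: Lc] IHn).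
exact/cong_sym/(c_cat_comm [:: x]).
Qed.

Lemma Mcong_nf w : Mcong w (nf w).
Proof.
rewrite /nf; case: ifPn => [|_]; last exact: cong_refl.
rewrite Lc_in_nbc => n_gt0; apply: (cong_trans (Mcong_c_del w)).
rewrite -(prednK n_gt0) -[in X in cong _ X _]addn1 -[in X in cong _ _ X]addn1 !nseqD -!catA.
exact/cong_catl/Mcong_c_nf.
Qed.

Lemma Mcong_nfP u v : Mcong u v <-> nf u = nf v.
Proof.
split=> [|uv]; first exact: nf_Mcong.
by apply: (cong_trans (Mcong_nf u)); rewrite uv; apply/cong_sym/Mcong_nf.
Qed.

Lemma unique_normal_form w : exists! u, normal_form u /\ Mcong u w.
Proof.
exists (nf w); split=> [|u [nu uw]].
  by split; [exact: nf_normal | apply/cong_sym/Mcong_nf].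
by rewrite -(normal_nf nu); apply/esym/nf_Mcong.
Qed.

(** * Automata for padded relations *)

Lemma regular_abs (X : Type) (Q : finType) (abs : seq X -> Q) (d : Q -> X -> Q)
    (fin : pred Q) :
  (forall s x, abs (rcons s x) = d (abs s) x) -> regular (fun s => fin (abs s)).
Proof.
move=> absE; exists (DFA (abs [::]) fin d) => s; rewrite /accepts /=.
have -> : foldl d (abs [::]) s = abs s.
  by elim/last_ind: s => // s x IH; rewrite foldl_rcons IH absE.
by [].
Qed.

Lemma regular_ext (X : Type) (P P' : seq X -> Prop) :
  (forall s, P s <-> P' s) -> regular P -> regular P'.
Proof. by move=> PP' [D DP]; exists D => s; rewrite DP PP'. Qed.

Lemma padR_rcons (A : Type) (u v : seq A) : size v = (size u).+1 ->
  padR u v = zip (rcons (map Some u) None) (map Some v).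
Proof.
move=> sv; rewrite /padR sv maxnE subSnn addn1 subSnn subnn cats0 cats1.
by [].
Qed.

Lemma padL_cons (A : Type) (u v : seq A) : size v = (size u).+1 ->
  padL u v = zip (None :: map Some u) (map Some v).
Proof. by move=> sv; rewrite /padL sv maxnE subSnn addn1 subSnn subnn. Qed.

(* The transducer lags one letter behind its input; in [padL_trans] it is v
   that is delayed by one letter instead, through the last state component. *)
Section Transducer.
Variables (A : finType) (Q : finType) (out : Q -> A -> A) (nxt : Q -> A -> Q) (fin : Q -> A).
Variable (D : dfa (A * A)).

Fixpoint transduce (q : Q) (u : seq A) : seq A :=
  if u is x :: u' then out q x :: transduce (nxt q x) u' else [:: fin q].

Lemma size_transduce q u : size (transduce q u) = (size u).+1.
Proof. by elim: u q => //= x u IH q; rewrite IH. Qed.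

Let acc (d : dstate D) s := dfinal (foldl (@dtrans _ D) d s).

(** [inl] is the state while u is being read; [inr b] records the verdict once u has ended, and any
    further letter turns it into rejection. *)
Definition padR_trans (st : Q * dstate D + bool) (xy : option A * option A) :
    Q * dstate D + bool :=
  match st, xy with
  | inl (q, d), (Some x, Some y) => inl (nxt q x, dtrans d (out q x, y))
  | inl (q, d), (None, Some y) => inr (dfinal (dtrans d (fin q, y)))
  | _, _ => inr false
  end.

Definition padR_final (st : Q * dstate D + bool) := if st is inr b then b else false.

Lemma padR_foldl_done b s :
  padR_final (foldl padR_trans (inr b) s) = b && nilp s.
Proof.
by elim: s b => [|xy s IH] b; rewrite ?andbT //= IH /= andbF.
Qed.

Lemma padR_foldl q d s : padR_final (foldl padR_trans (inl (q, d)) s) <->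
  exists u v, [/\ size v = (size u).+1, acc d (zip (transduce q u) v) &
                  s = zip (rcons (map Some u) None) (map Some v)].
Proof.
elim: s q d => [|[x y] s IH] q d.
  by split=> // -[[|x u] [[|y v] [// _ _ ]]].
case: x => [x|]; case: y => [y|]; rewrite [foldl _ _ _]/=.
- rewrite IH; split=> [[u [v [suv ac ->]]]|[[|x' u] [[|y' v] [// suv ac []]]]].
    by exists (x :: u), (y :: v); rewrite /= suv.
  by move=> ? ? ->; subst x' y'; exists u, v; split=> //; case: suv.
- rewrite padR_foldl_done; split=> // -[[|x' u] [[|y' v] [//]]].
- rewrite padR_foldl_done; split=> [/andP[ac /nilP ->]|].
    by exists [::], [:: y].
  move=> [[|x' u] [[|y' [|y'' v]] [//]]] _ ac [-> ->].
  by rewrite andbT.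
- by rewrite padR_foldl_done; split=> // -[[|x' u] [[|y' v] [//]]].
Qed.

(** The outer [None] is the rejecting sink; [Some None] waits for the initial pair in which u is
    padded. *)
Definition padL_trans (st : option (option (Q * dstate D * A))) (q0 : Q)
    (xy : option A * option A) : option (option (Q * dstate D * A)) :=
  match st, xy with
  | Some None, (None, Some y) => Some (Some (q0, dinit D, y))
  | Some (Some (q, d, z)), (Some x, Some y) => Some (Some (nxt q x, dtrans d (out q x, z), y))
  | _, _ => None
  end.

Definition padL_final (st : option (option (Q * dstate D * A))) :=
  if st is Some (Some (q, d, z)) then dfinal (dtrans d (fin q, z)) else false.

Lemma padL_foldl q0 q d z s :
  padL_final (foldl (padL_trans^~ q0) (Some (Some (q, d, z))) s) <->
  exists u v, [/\ size v = size u, acc d (zip (transduce q u) (z :: v)) &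
                  s = zip (map Some u) (map Some v)].
Proof.
have dead s' : padL_final (foldl (padL_trans^~ q0) None s') = false.
  by elim: s'.
elim: s q d z => [|[x y] s IH] q d z.
  by split=> [ac|[[|x u] [[|y v] [//]]]]; exists [::], [::].
case: x => [x|]; case: y => [y|]; rewrite [foldl _ _ _]/= ?dead.
- rewrite IH; split=> [[u [v [suv ac ->]]]|[[|x' u] [[|y' v] [// suv ac []]]]].
    by exists (x :: u), (y :: v); rewrite /= suv.
  by move=> ? ? ->; subst x' y'; exists u, v; split=> //; case: suv.
- by split=> // -[[|x' u] [[|y' v] [//]]].
- by split=> // -[[|x' u] [[|y' v] [//]]].
- by split=> // -[[|x' u] [[|y' v] [//]]].
Qed.

Variables (q0 : Q) (Rel : seq A -> seq A -> Prop).
Hypothesis RelE : forall u v,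
  Rel u v <-> size v = (size u).+1 /\ accepts D (zip (transduce q0 u) v).

Lemma regular_padR : regular (padded (@padR A) Rel).
Proof.
exists (DFA (inl (q0, dinit D)) padR_final padR_trans) => s.
rewrite /accepts /= padR_foldl; split=> -[u [v]].
  move=> [suv ac ->]; exists u, v; rewrite RelE padR_rcons //.
by rewrite RelE => -[[suv ac] ->]; exists u, v; rewrite padR_rcons.
Qed.

Lemma regular_padL : regular (padded (@padL A) Rel).
Proof.
exists (DFA (Some None) padL_final (padL_trans^~ q0)) => s.
have dead s' : padL_final (foldl (padL_trans^~ q0) None s') = false.
  by elim: s'.
rewrite /accepts /=; split=> [|[u [v]]].
  case: s => [//|[[x|] [y|]] s] /=; rewrite ?dead // padL_foldl.
  move=> [u [v [suv ac ->]]]; exists u, (y :: v).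
  by rewrite RelE padL_cons /= suv.
rewrite RelE => -[[suv ac] ->]; rewrite padL_cons //.
case: v suv ac => // y v [suv] ac; rewrite /= padL_foldl.
by exists u, v.
Qed.

End Transducer.

(** * The representatives c^*{a,b}^* and biautomaticity *)

Fixpoint cpref (w : seq abc) : bool :=
  if w is x :: w' then if x == Lc then cpref w' else all (predC1 Lc) w' else true.

Lemma cpref_rcons w x :
  cpref (rcons w x) = cpref w && ((x != Lc) || all (pred1 Lc) w).
Proof.
elim: w => [|y w IH] /=; first by case: eqP.
by case: (y == Lc) => //=; rewrite all_rcons /= orbF andbC.
Qed.

Lemma cpref_nseq n w : cpref (nseq n Lc ++ del_c w).
Proof.
elim: n => //=; elim: w => //= x w IH; case: ifP => //= /negbTE ->.
by apply/allP => y; rewrite mem_filter => /andP[].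
Qed.

Lemma nbc_eq0 w : all (predC1 Lc) w = (nbc w == 0).
Proof. by rewrite all_predC has_count -leqNgt leqn0. Qed.

(** An automaton cannot count c's. For words of [cpref] of equal length, however, having equally
    many c's means having them at the same positions, which is a letterwise test. *)
Definition same_c (xy : abc * abc) := (xy.1 == Lc) == (xy.2 == Lc).

Lemma same_c_nbc u v : size u = size v -> all same_c (zip u v) -> nbc u = nbc v.
Proof.
elim: u v => [|x u IH] [|y v] //= [suv] /andP[/eqP /= xy uv].
by rewrite /nbc /= xy; congr (_ + _); apply: IH.
Qed.

Lemma same_c_cpref u v :
  size u = size v -> all same_c (zip u v) -> cpref u -> cpref v.
Proof.
elim: u v => [|x u IH] [|y v] //= [suv] /andP[/eqP /= <- uv].
case: ifP => _; first exact: IH.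
by rewrite !nbc_eq0 (same_c_nbc suv uv).
Qed.

Lemma cpref_same_c u v :
  size u = size v -> cpref u -> cpref v -> nbc u = nbc v -> all same_c (zip u v).
Proof.
have noc u' v' : size u' = size v' -> all (predC1 Lc) u' -> all (predC1 Lc) v' ->
    all same_c (zip u' v').
  elim: u' v' => [|x u' IH] [|y v'] //= [suv] /andP[xc uc] /andP[yc vc].
  by rewrite IH // /same_c /= (negbTE xc) (negbTE yc).
elim: u v => [|x u IH] [|y v] //= [suv]; rewrite /same_c /nbc /=.
case: eqP => _; case: eqP => _ cu cv //=.
- by case=> nuv; apply: IH.
- by move: cv; rewrite nbc_eq0 => /eqP; rewrite /nbc => ->.
- by move: cu; rewrite nbc_eq0 => /eqP; rewrite /nbc => ->.
- by move=> _; apply: noc.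
Qed.

Definition cmp (s : seq (abc * abc)) : bool :=
  [&& cpref (unzip1 s), all same_c s &
      (unzip1 s == unzip2 s) ||
      (Lc \in unzip1 s) && (trail (unzip1 s) == trail (unzip2 s))].

Lemma cmpP u v : size u = size v ->
  cmp (zip u v) <-> [/\ cpref u, cpref v & Mcong u v].
Proof.
move=> suv; rewrite /cmp unzip1_zip ?suv // unzip2_zip ?suv //.
split=> [/and3P[cu sc uv]|[cu cv /Mcong_inv[_ nuv tuv inj]]].
  split=> //; first exact: same_c_cpref sc cu.
  apply/Mcong_nfP; have nuv := same_c_nbc suv sc.
  case/orP: uv => [/eqP ->//|/andP[]]; rewrite Lc_in_nbc nuv => n_gt0 /eqP tuv.
  by rewrite /nf !Lc_in_nbc !size_del_c suv nuv tuv n_gt0.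
rewrite cu cpref_same_c //= Lc_in_nbc tuv eqxx andbT.
by case: posnP => [/inj ->|]; rewrite ?eqxx ?orbT.
Qed.

Lemma regular_cmp : regular cmp.
Proof.
pose st := (bool * bool * bool * bool * bool * bool)%type.
(* Equality of trails alone cannot be updated when a c faces an a. Joined with [all same_c] it can:
   such pairs give false, a pair of b's resets both trails to 0, and an a facing a b leaves one
   trail positive and the other 0. *)
pose abs (s : seq (abc * abc)) : st :=
  (cpref (unzip1 s), all (pred1 Lc) (unzip1 s), all same_c s, unzip1 s == unzip2 s,
   Lc \in unzip1 s, all same_c s && (trail (unzip1 s) == trail (unzip2 s))).
pose d (q : st) (xy : abc * abc) : st :=
  let: (l, k, s, e, h, g) := q in let: (x, y) := xy in
  (l && ((x != Lc) || k), (x == Lc) && k, same_c xy && s, e && (x == y), (Lc == x) || h,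
   match x, y with Lb, Lb => s | La, La | Lc, Lc => g | _, _ => false end).
pose fin (q : st) := let: (l, k, s, e, h, g) := q in [&& l, s & e || h && g].
have absE s xy : abs (rcons s xy) = d (abs s) xy.
  case: xy => x y; rewrite /abs /d /unzip1 /unzip2 !map_rcons /= cpref_rcons !all_rcons.
  rewrite eqseq_rcons mem_rcons in_cons /trail !foldl_rcons.
  by case: x; case: y; rewrite /= ?andbF ?andbT ?eqSS.
apply: regular_ext (regular_abs fin absE) => s; rewrite /fin /abs /cmp.
by case: (all same_c s).
Qed.

(** Insertion of a letter right after the initial c's: the state is [None] within these c's and
    afterwards holds the input letter still to be output. *)
Definition ins_nxt (q : option abc) (x : abc) :=
  if q is None then if x == Lc then None else Some x else Some x.

Definition ins_out (a : abc) (q : option abc) (x : abc) :=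
  if q is Some y then y else if x == Lc then Lc else a.

Notation ins a := (@transduce abc (option abc) (ins_out a) ins_nxt (odflt a)).
Notation app a := (@transduce abc unit (fun=> id) (fun _ _ => tt) (fun _ => a) tt).

Lemma appE a u : app a u = rcons u a.
Proof. by elim: u => //= x u ->. Qed.

Lemma ins_pending a y u : ins a (Some y) u = y :: u.
Proof. by elim: u y => //= x u IH y; rewrite IH. Qed.

Lemma insE a u : cpref u -> ins a None u = nseq (nbc u) Lc ++ a :: del_c u.
Proof.
elim: u => //= x u IH; rewrite /nbc /=; case: eqP => [-> /IH -> //|_] /[dup].
rewrite {1}nbc_eq0 => /eqP; rewrite /nbc => -> /all_filterP; rewrite /del_c => ->.
by rewrite ins_pending.
Qed.

Lemma cpref_del_c u : cpref u -> nseq (nbc u) Lc ++ del_c u = u.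
Proof.
elim: u => //= x u IH; rewrite /nbc /=; case: eqP => [-> /IH uE|_ /[dup]].
  by congr (_ :: _).
by rewrite {1}nbc_eq0 => /eqP; rewrite /nbc => -> /all_filterP; rewrite /del_c => ->.
Qed.

Lemma cpref_app a u : a != Lc -> cpref (app a u) = cpref u.
Proof. by move=> ac; rewrite appE cpref_rcons ac andbT. Qed.

Lemma cpref_ins a u : cpref (ins a None u) = cpref u.
Proof.
elim: u => [|x u IH] /=; first by case: ifP.
case: (eqVneq x Lc) => [_|xc] //=.
by rewrite ins_pending /= (negbTE xc); case: eqP.
Qed.

Lemma Mcong_ins a u : cpref u -> Mcong (ins a None u) (a :: u).
Proof.
move=> cu; rewrite (insE _ cu) -{3}(cpref_del_c cu).
elim: (nbc u) => [|n IH]; first exact: cong_refl.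
exact: cong_trans (cong_catl [:: Lc] IH) (c_cat_comm [:: a] _).
Qed.

Lemma biautomatic_Mrel : biautomatic Mrel.
Proof.
pose gen (x : abc) := [:: x]; pose L (u : seq abc) : Prop := cpref u.
have genE u : ext gen u = u by rewrite /ext; elim: u => //= x u ->.
have [D Dcmp] := regular_cmp.
exists abc, gen, L; split.
  split; last first.
    move=> w; exists (nseq (nbc w) Lc ++ del_c w); rewrite /L cpref_nseq genE.
    by split=> //; apply/cong_sym/Mcong_c_del.
  pose d (q : bool * bool) x := (q.1 && ((x != Lc) || q.2), (x == Lc) && q.2).
  apply: (@regular_abs _ (bool * bool)%type (fun u => (cpref u, all (pred1 Lc) u)) d fst).
  by move=> u x; rewrite cpref_rcons all_rcons.
(* The relations of M preserve length, so a related v is exactly one letter longer than u, as the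
   transducer automata require. *)
have relE (Q : finType) out nxt fin (q : Q) w (Rel : seq abc -> seq abc -> Prop) :
    (forall u v, Rel u v <-> [/\ L u, L v & Mcong (w u) v]) ->
    (forall u, size (w u) = (size u).+1) ->
    (forall u, cpref (transduce out nxt fin q u) = cpref u) ->
    (forall u, cpref u -> Mcong (transduce out nxt fin q u) (w u)) ->
    forall u v, Rel u v <->
      size v = (size u).+1 /\ accepts D (zip (transduce out nxt fin q u) v).
  move=> RelE size_w cpref_F Mcong_F u v; rewrite RelE Dcmp.
  split=> [[Lu Lv uv]|[suv]].
    have suv : size v = (size u).+1 by rewrite -size_w; case: (Mcong_inv uv).
    split=> //; apply/cmpP; first by rewrite size_transduce.
    by rewrite cpref_F; split=> //; apply: cong_trans (Mcong_F _ Lu) uv.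
  case/cmpP; first by rewrite size_transduce.
  rewrite cpref_F => Lu Lv uv; split=> //.
  exact: cong_trans (cong_sym (Mcong_F _ Lu)) uv.
move=> a.
have left_ins := relE _ (ins_out a) ins_nxt (odflt a) None (cons a) (Lleft Mrel gen L a).
have right_ins := relE _ (ins_out a) ins_nxt (odflt a) None (rcons^~ a) (Lright Mrel gen L a).
have right_app := relE _ (fun=> id) (fun _ _ => tt) (fun=> a) tt (rcons^~ a) (Lright Mrel gen L a).
have leftE u v : Lleft Mrel gen L a u v <-> [/\ L u, L v & Mcong (a :: u) v].
  by rewrite /Lleft !genE; split=> [[? []]|[]].
have rightE u v : Lright Mrel gen L a u v <-> [/\ L u, L v & Mcong (rcons u a) v].
  by rewrite /Lright !genE cats1; split=> [[? []]|[]].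
have {}left_ins := left_ins leftE (fun=> erefl) (cpref_ins a) (Mcong_ins a).
(* Appending c could leave the language, so right multiplication by c is done by insertion, c being
   central; a and b are appended. *)
have [ac|ac] := eqVneq a Lc.
  have {}right_ins := right_ins rightE (fun u => size_rcons u a) (cpref_ins a).
  have Mcong_F u : cpref u -> Mcong (ins a None u) (rcons u a).
    by move=> /(Mcong_ins a)/cong_trans; apply; rewrite ac; apply: c_central.
  by split; [apply: regular_padR (right_ins Mcong_F) | apply: regular_padR left_ins |
    apply: regular_padL (right_ins Mcong_F) | apply: regular_padL left_ins].
have {}right_app := right_app rightE (fun u => size_rcons u a) (fun u => cpref_app u ac).
have Mcong_F u : cpref u -> Mcong (app a u) (rcons u a).
  by rewrite appE => _; apply: cong_refl.
by split; [apply: regular_padR (right_app Mcong_F) | apply: regular_padR left_ins |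
  apply: regular_padL (right_app Mcong_F) | apply: regular_padL left_ins].
Qed.

Lemma biautomatic_automatic (A0 : finType) (R0 : pres A0) :
  biautomatic R0 -> automatic R0.
Proof.
move=> [A [gen [L [repL reg]]]]; exists A, gen, L; split=> // a.
by case: (reg a).
Qed.

(** * Weights of steps between words over a, b, c *)

Definition letter_b (j : nat) (w : seq abc) : bool := nth La (del_c w) j == Lb.

Definition wt (j : nat) (u v : seq abc) : bool :=
  letter_b j u && (letter_b 0 u (+) letter_b 0 v).

Lemma wt_refl j u : wt j u u = false.
Proof. by rewrite /wt addbb andbF. Qed.

Lemma wt_del_c j u v : del_c u = del_c v -> wt j u v = false.
Proof. by rewrite /wt /letter_b => ->; rewrite addbb andbF. Qed.

(** If x has a letter other than c, the first letter lies in x. Otherwise position [j] lies beyond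
    the window t, whose n letters other than c fill only positions below [j]. *)
Lemma letter_b_window j x y n : n <= j ->
  (exists b, forall t, letter_b 0 (x ++ t ++ y) = b) \/
  (exists b, forall t, size (del_c t) = n -> letter_b j (x ++ t ++ y) = b).
Proof.
move=> nj; case Ex: (del_c x) => [|z x'].
  right; exists (nth La (del_c y) (j - n) == Lb) => t tn.
  by rewrite /letter_b !del_c_cat Ex /= nth_cat tn ltnNge nj.
by left; exists (z == Lb) => t; rewrite /letter_b !del_c_cat Ex.
Qed.

Section WindowWeight.
Variables (j : nat) (x y s t z : seq abc).
Hypotheses (small : size s <= j) (st : Mcong s t) (sz : Mcong s z).

Let small_c : size (del_c s) <= j.
Proof. by apply: leq_trans small; rewrite size_filter count_size. Qed.

(** Either the first letter is fixed and all weights vanish, or the factor at position [j] is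
    constant and the changes of the first letter telescope. *)
Lemma wt_window :
  wt j (x ++ s ++ y) (x ++ t ++ y) (+) wt j (x ++ t ++ y) (x ++ z ++ y) =
  wt j (x ++ s ++ y) (x ++ z ++ y).
Proof.
rewrite /wt; have [[b bE]|[b bE]] := letter_b_window x y small_c.
  by rewrite !bE addbb !andbF.
rewrite !bE ?(Mcong_size_del_c st) //.
by case: b {bE}; rewrite //= addbA addbK.
Qed.

Lemma wt_sym : wt j (x ++ s ++ y) (x ++ t ++ y) = wt j (x ++ t ++ y) (x ++ s ++ y).
Proof.
rewrite /wt; have [[b bE]|[b bE]] := letter_b_window x y small_c.
  by rewrite !bE addbb !andbF.
by rewrite !bE ?(Mcong_size_del_c st) // addbC.
Qed.

End WindowWeight.

Lemma cat_eq_cat (T : Type) (a b c d : seq T) : a ++ b = c ++ d ->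
  (exists e, c = a ++ e /\ b = e ++ d) \/ (exists e, a = c ++ e /\ d = e ++ b).
Proof.
elim: a c => [|x a IH] [|y c] /=.
- by move=> <-; left; exists [::].
- by move=> ->; left; exists (y :: c).
- by move=> <-; right; exists (x :: a).
by case=> -> /IH [] [e [-> ->]]; [left|right]; exists e.
Qed.

(** A word that is not accessible has a successor that is not accessible; choosing such successors
    repeatedly gives an infinite reduction. *)
Lemma noetherian_wf (B : Type) (R : pres B) :
  noetherian R -> well_founded (fun v u => step R u v).
Proof.
move=> noeth u; apply: NNPP => nacc; apply: noeth.
pose T := {v | ~ Acc (fun v u => step R u v) v}.
have next (v : T) : {v' : T | step R (sval v) (sval v')}.
  apply: constructive_indefinite_description; apply: NNPP => no.
  apply: (svalP v); split=> v' vv'; apply: NNPP => nv'.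
  by apply: no; exists (exist _ v' nv').
pose f := fix f n : T := if n is n'.+1 then sval (next (f n')) else exist _ u nacc.
exists (fun n => sval (f n)) => n; exact: (svalP (next (f n))).
Qed.

(** * Weights transported to an arbitrary presentation of M *)

Section PresentationWeight.
Variables (B : Type) (R : pres B) (phi : B -> seq abc) (j : nat).
Implicit Types u v w x y : seq B.
Hypothesis phi_cong : forall u v, cong R u v -> Mcong (ext phi u) (ext phi v).
Hypothesis rule_small : forall l r, List.In (l, r) R -> size (ext phi l) <= j.

Definition phi_wt u v := wt j (ext phi u) (ext phi v).

Lemma phi_wt_window x y s t z : size (ext phi s) <= j -> cong R s t -> cong R s z ->
  phi_wt (x ++ s ++ y) (x ++ t ++ y) (+) phi_wt (x ++ t ++ y) (x ++ z ++ y) =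
  phi_wt (x ++ s ++ y) (x ++ z ++ y).
Proof.
by move=> small st sz; rewrite /phi_wt !ext_cat wt_window //; apply: phi_cong.
Qed.

Lemma phi_wt_rule_sym x y l r : List.In (l, r) R ->
  phi_wt (x ++ l ++ y) (x ++ r ++ y) = phi_wt (x ++ r ++ y) (x ++ l ++ y).
Proof.
move=> lr; rewrite /phi_wt !ext_cat wt_sym //; first exact: rule_small lr.
exact/phi_cong/cong_rule.
Qed.

Inductive wpath (S : seq B -> seq B -> Prop) : seq B -> seq B -> bool -> Prop :=
| wpath_nil u : wpath S u u false
| wpath_cons u v w k : S u v -> wpath S v w k -> wpath S u w (phi_wt u v (+) k).

Definition zigzag u v := step R u v \/ step R v u.

Lemma wpath_cat S u v w k k' :
  wpath S u v k -> wpath S v w k' -> wpath S u w (k (+) k').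
Proof.
by elim=> // {u v k} u v v' k uv _ IH /IH vw; rewrite -addbA; apply: wpath_cons vw.
Qed.

(** By telescoping, a path inside a small window weighs as much as the single jump between its
    endpoints, whatever words it visits. *)
Lemma wpath_window (S : seq B -> seq B -> Prop) x y s t :
  (forall u v, S u v -> S (x ++ u ++ y) (x ++ v ++ y)) ->
  (forall u v, S u v -> cong R u v) ->
  clos_refl_trans _ S s t -> size (ext phi s) <= j ->
  wpath S (x ++ s ++ y) (x ++ t ++ y) (phi_wt (x ++ s ++ y) (x ++ t ++ y)).
Proof.
move=> S_ctx S_cong /clos_rt_rt1n_iff st.
elim: st => {s t} [s _|s t z st tz IH small]; first by rewrite [phi_wt _ _]wt_refl; apply: wpath_nil.
have tz' : cong R t z.
  elim: tz {IH} => [u|u v w /S_cong uv _]; [exact: cong_refl | exact: cong_trans].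
have {}st' := S_cong _ _ st.
rewrite -(phi_wt_window x y small st' (cong_trans st' tz')).
apply: wpath_cons (IH _); first exact: S_ctx.
by case/phi_cong/Mcong_inv: st' => <-.
Qed.

Lemma zigzag_ctx x y u v : zigzag u v -> zigzag (x ++ u ++ y) (x ++ v ++ y).
Proof. by case=> uv; [left|right]; apply: step_ctx. Qed.

Lemma zigzag_cong u v : zigzag u v -> cong R u v.
Proof. by case=> uv; [|apply: cong_sym]; apply: rst_step. Qed.

Definition phi_wt_coherent := forall u v k k', nbc (ext phi u) = 1 ->
  wpath zigzag u v k -> wpath zigzag u v k' -> k = k'.

(* The square "rewrite the first or the last ab of c ab b^n ab first" is a
   loop of weight 1. *)
Lemma phi_wt_incoherent (psi : abc -> seq B) :
  (forall u v, Mcong (ext phi u) (ext phi v) -> cong R u v) ->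
  (forall x : abc, Mcong (ext phi (ext psi [:: x])) [:: x]) ->
  2 < j -> ~ phi_wt_coherent.
Proof.
move=> phi_inj phi_psi j_gt2 coh.
have phi_psi1 (x : abc) : ext phi (psi x) = [:: x].
  move: (phi_psi x); rewrite ext_seq1 => /Mcong_inv[].
  case: (ext phi (psi x)) => [|y [|//]] // _; rewrite /nbc /=.
  by case: x; case: y => //= _ _ /(_ erefl).
have phiK (w : seq abc) : ext phi (ext psi w) = w.
  by elim: w => // x w IH; rewrite -cat1s (ext_cat psi) ext_seq1 ext_cat IH phi_psi1.
pose reach (u v : seq abc) := wpath zigzag (ext psi u) (ext psi v).
(* A relation of M lifts to some path of R; the window has length at most 3, so the weight of this
   unknown path depends on its endpoints only. *)
have reach_step (x y s t : seq abc) : Mcong s t -> size s <= 3 ->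
    reach (x ++ s ++ y) (x ++ t ++ y) (wt j (x ++ s ++ y) (x ++ t ++ y)).
  move=> st s_small; rewrite /reach !ext_cat.
  have := @wpath_window zigzag (ext psi x) (ext psi y) (ext psi s) (ext psi t)
    (@zigzag_ctx _ _) zigzag_cong.
  rewrite /phi_wt !ext_cat !phiK; apply.
    by apply/cong_rt_sym/phi_inj; rewrite !phiK.
  exact: leq_trans j_gt2.
have reach0 (u v w : seq abc) k : reach u v false -> reach v w k -> reach u w k.
  exact: wpath_cat.
have move_c1 (x : seq abc) z (y : seq abc) : reach (x ++ Lc :: z :: y) (x ++ z :: Lc :: y) false /\
                   reach (x ++ z :: Lc :: y) (x ++ Lc :: z :: y) false.
  have cz := c_central [:: z].
  split; [have := reach_step x y _ _ cz isT | have := reach_step x y _ _ (cong_sym cz) isT];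
    by rewrite wt_del_c // !del_c_cat; case: z {cz}.
have move_c (x w y : seq abc) : reach (x ++ Lc :: w ++ y) (x ++ w ++ Lc :: y) false /\
                  reach (x ++ w ++ Lc :: y) (x ++ Lc :: w ++ y) false.
  elim: w x => [|z w IH] x; first by split; apply: wpath_nil.
  have [cz zc] := move_c1 x z (w ++ y); have [] := IH (rcons x z).
  by rewrite !cat_rcons => cw wc; split; [exact: reach0 cz cw | exact: reach0 wc zc].
have rule : Mcong [:: Lc; La; Lb] [:: Lc; Lb; Lb] by apply: cong_rule; do 2!right; left.
(* With two letters in front of [m], position [j], counted from 0 without the c's, is the first
   letter of the last pair. *)
pose m := nseq (j - 2) Lb.
have letter (x1 x2 x3 x4 : abc) (y : seq abc) : x1 != Lc -> x2 != Lc -> x3 != Lc -> x4 != Lc ->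
    (letter_b j (Lc :: x1 :: x2 :: m ++ [:: x3, x4 & y]) = (x3 == Lb)) /\
    (letter_b j (x1 :: x2 :: m ++ [:: Lc, x3, x4 & y]) = (x3 == Lb)).
  move=> c1 c2 c3 c4; rewrite /letter_b /= c1 c2 !del_c_cat /= c3.
  have -> : del_c m = m by apply/all_filterP; rewrite all_nseq orbT.
  have -> : j = (size m).+2 by rewrite size_nseq -addn2 subnK // ltnW.
  by rewrite /= !nth_cat ltnn subnn.
pose src := [:: Lc, La, Lb & m ++ [:: La; Lb]]; pose tgt := [:: Lb, Lb & m ++ [:: Lc; Lb; Lb]].
(* First pair first: position [j] is still an a while the first letter changes. *)
have reach_false : reach src tgt false.
  have := reach_step [::] (m ++ [:: La; Lb]) _ _ rule isT.
  rewrite /= {1}/wt (letter La Lb La Lb [::] isT isT isT isT).1 //= => first.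
  apply: (reach0 _ _ _ _ first).
  have [cm _] := move_c [::] [:: Lb, Lb & m] [:: La; Lb]; apply: (reach0 _ _ _ _ cm).
  have := reach_step [:: Lb, Lb & m] [::] _ _ rule isT.
  by rewrite /= {1}/wt (letter Lb Lb La Lb [::] isT isT isT isT).2.
(* Last pair first: position [j] has become a b when the first letter changes, which contributes
   1. *)
have reach_true : reach src tgt true.
  have [cm _] := move_c [::] [:: La, Lb & m] [:: La; Lb]; apply: (reach0 _ _ _ _ cm).
  have := reach_step [:: La, Lb & m] [::] _ _ rule isT.
  rewrite /= {1}/wt (letter La Lb La Lb [::] isT isT isT isT).2 //= => first.
  apply: (reach0 _ _ _ _ first).
  have [_ mc] := move_c [::] [:: La, Lb & m] [:: Lb; Lb]; apply: (reach0 _ _ _ _ mc).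
  have := reach_step [::] (m ++ [:: Lb; Lb]) _ _ rule isT.
  rewrite /= {1}/wt (letter La Lb Lb Lb [::] isT isT isT isT).1 //= => second.
  have [cm' _] := move_c [::] [:: Lb, Lb & m] [:: Lb; Lb].
  exact: wpath_cat second cm'.
have := coh _ _ _ _ _ reach_false reach_true.
rewrite phiK /nbc /= count_cat count_nseq /= => /(_ erefl).
by [].
Qed.

(** * Homotopic paths have equal weights *)

Section Homotopy.
Implicit Types (es : seq (edge B)) (e : edge B).

(** The outer context [x], [y] is kept as a parameter because the weight is not invariant under
    context, while homotopy is closed under it. *)
Definition edges_wt x y es : bool :=
  foldr (fun e k => phi_wt (x ++ esrc e ++ y) (x ++ etgt e ++ y) (+) k) false es.

Lemma edges_wt_cat x y es es' :
  edges_wt x y (es ++ es') = edges_wt x y es (+) edges_wt x y es'.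
Proof. by elim: es => //= e es ->; rewrite addbA. Qed.

Lemma edges_wt_whisk x y x' y' p :
  edges_wt x y (whisk x' p y').2 = edges_wt (x ++ x') (y' ++ y) p.2.
Proof.
rewrite /=; elim: p.2 => //= e es ->; congr (phi_wt _ _ (+) _);
  by rewrite /esrc /etgt /= -!catA.
Qed.

Lemma edge_cong e : edge_ok R e -> cong R (esrc e) (etgt e).
Proof.
rewrite /edge_ok; case: e => x [l r] y d /= /cong_rule lr; case: d; apply: cong_ctx => //.
exact: cong_sym.
Qed.

Lemma edge_W_sym x y e : edge_ok R e ->
  phi_wt (x ++ esrc e ++ y) (x ++ etgt e ++ y) = phi_wt (x ++ etgt e ++ y) (x ++ esrc e ++ y).
Proof.
rewrite /edge_ok; case: e => x' [l r] y' d /= lr; have := phi_wt_rule_sym (x ++ x') (y' ++ y) lr.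
by rewrite /esrc /etgt /= -!catA; case: d => //= ->.
Qed.

Lemma edges_wt_pinv x y p : valid R p -> edges_wt x y (pinv p).2 = edges_wt x y p.2.
Proof.
case: p => w es; rewrite /valid /=; elim: es w => //= e es IH w [ok [_ ch]].
rewrite rev_cons -cats1 edges_wt_cat (IH _ ch) addbC /= addbF (edge_W_sym x y ok).
by case: e {ok ch} => x' rho y' [].
Qed.

Lemma chain_cong w es : chain R w es -> cong R w (last w (map (@etgt B) es)).
Proof.
elim: es w => [|e es IH] w /=; first by move=> _; apply: cong_refl.
by move=> [ok [<- /IH]]; apply/cong_trans/edge_cong.
Qed.

Lemma edges_wt_window x y w es : chain R w es -> size (ext phi w) <= j ->
  edges_wt x y es = phi_wt (x ++ w ++ y) (x ++ last w (map (@etgt B) es) ++ y).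
Proof.
elim: es w => [|e es IH] w /=; first by rewrite [phi_wt _ _]wt_refl.
move=> [ok [<- ch]] small; have uv := edge_cong ok.
rewrite (IH _ ch); last by case/phi_cong/Mcong_inv: uv => <-.
apply: phi_wt_window => //; exact: cong_trans uv (chain_cong ch).
Qed.

Lemma nbc_ext_cong x y u v : cong R u v ->
  nbc (ext phi (x ++ u ++ y)) = nbc (ext phi (x ++ v ++ y)).
Proof. by move=> /(cong_ctx x y)/phi_cong/Mcong_inv[]. Qed.

(** A word without c is alone in its class, so such a rule is an equality of words over a, b, c. *)
Lemma rule_nbc0 rho d : List.In rho R -> nbc (ext phi (rsrc rho d)) = 0 ->
  ext phi (rsrc rho d) = ext phi (rtgt rho d).
Proof.
case: rho => l r /cong_rule/phi_cong; case: d => /= lr; first by case/Mcong_inv: lr.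
by case/cong_sym/Mcong_inv: lr.
Qed.

(* A square of disjoint rewritings involves two occurrences of c unless one
   of the two rewritings is invisible in M. *)
Lemma phi_wt_disjoint x y m rho1 d1 rho2 d2 : List.In rho1 R -> List.In rho2 R ->
  let l1 := rsrc rho1 d1 in let r1 := rtgt rho1 d1 in
  let l2 := rsrc rho2 d2 in let r2 := rtgt rho2 d2 in
  nbc (ext phi (x ++ l1 ++ m ++ l2 ++ y)) = 1 ->
  phi_wt (x ++ l1 ++ m ++ l2 ++ y) (x ++ r1 ++ m ++ l2 ++ y) (+)
    phi_wt (x ++ r1 ++ m ++ l2 ++ y) (x ++ r1 ++ m ++ r2 ++ y) =
  phi_wt (x ++ l1 ++ m ++ l2 ++ y) (x ++ l1 ++ m ++ r2 ++ y) (+)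
    phi_wt (x ++ l1 ++ m ++ r2 ++ y) (x ++ r1 ++ m ++ r2 ++ y).
Proof.
move=> R1 R2 l1 r1 l2 r2; rewrite /phi_wt !ext_cat !nbc_cat => c1.
have [/(rule_nbc0 R1) <-|n1] := eqVneq (nbc (ext phi l1)) 0.
  by rewrite -/l1 !wt_refl addbF.
have/(rule_nbc0 R2) <- : nbc (ext phi l2) = 0.
  move: n1 c1; rewrite -/l2 -/l1.
  by case: (nbc (ext phi l1)) => // n _; case: (nbc (ext phi l2)) => // n'; rewrite !(addnS, addSn).
by rewrite -/l2 !wt_refl addbF.
Qed.

(** Induction on the homotopy. Base pairs start in a window of length at most [j], so their weights
    depend on the common endpoints; inverses cancel because rule weights are symmetric; disjoint
    rewritings are handled by [phi_wt_disjoint]. *)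
Lemma homotopic_wt (H : Defs.path B -> Defs.path B -> Prop) p q :
  (forall p q, H p q -> parallel R p q) ->
  (forall p q, H p q -> size (ext phi p.1) <= j) ->
  homotopic R H p q ->
  p.1 = q.1 /\ forall x y, nbc (ext phi (x ++ p.1 ++ y)) = 1 ->
    edges_wt x y p.2 = edges_wt x y q.2.
Proof.
move=> Hpar Hsmall; elim=> {p q}.
- move=> p q Hpq; have [chp chq pq1 pq2] := Hpar _ _ Hpq; split=> // x y _.
  have small := Hsmall _ _ Hpq.
  rewrite (edges_wt_window x y chp) // (edges_wt_window x y chq) -?pq1 //.
  by move: pq2; rewrite /ptgt -pq1 => ->.
- by [].
- by move=> p q _ [-> pq]; split=> // x y /pq.
- by move=> p q r _ [-> pq] _ [qr1 qr]; split=> // x y /[dup] /pq -> /qr.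
- move=> x' y' p q _ [pq1 pq]; split; first by rewrite /= pq1.
  by move=> x y c1; rewrite !edges_wt_whisk pq // -c1 /= -!catA.
- move=> p q r _ [pq1 pq] _ _; split=> // x y c1.
  by rewrite !edges_wt_cat pq.
- move=> p q r _ [pq1 pq] val_r rp; split=> // x y c1.
  rewrite !edges_wt_cat pq // -c1 -rp; apply/esym/nbc_ext_cong.
  exact: chain_cong.
- by move=> p val_p; split=> // x y _; rewrite edges_wt_cat edges_wt_pinv // addbb.
- move=> rho1 d1 rho2 d2 w R1 R2; split=> // x y.
  rewrite /= /esrc /etgt /= !cats0 -!catA !addbF => c1.
  exact: (phi_wt_disjoint R1 R2 c1).
Qed.

Lemma wpath_edges u v k : wpath zigzag u v k ->
  exists es, [/\ chain R u es, last u (map (@etgt B) es) = v & edges_wt [::] [::] es = k].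
Proof.
elim=> {u v k} [u|u v w k uv _ [es [ch <- <-]]]; first by exists [::].
have [e [ok eu ev]] : exists e, [/\ edge_ok R e, esrc e = u & etgt e = v].
  case: uv => -[x [l [r [y [lr [-> ->]]]]]].
    by exists (Edge x (l, r) y true).
  by exists (Edge x (l, r) y false).
subst u v; exists (e :: es); split=> //.
by rewrite /edges_wt /= !cats0.
Qed.

End Homotopy.

Lemma homotopy_base_coherent (Hs : seq (Defs.path B * Defs.path B)) :
  (forall p q, List.In (p, q) Hs -> parallel R p q) ->
  (forall p q, parallel R p q ->
    homotopic R (fun p' q' => List.In (p', q') Hs) p q) ->
  (forall p q, List.In (p, q) Hs -> size (ext phi p.1) <= j) ->
  phi_wt_coherent.
Proof.
move=> Hpar base Hsmall u v k k' c1 /wpath_edges[es [ch tgt <-]] /wpath_edges[es' [ch' tgt' <-]].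
have par : parallel R (u, es) (u, es') by split; rewrite // /ptgt /= tgt.
have [_] := homotopic_wt Hpar Hsmall (base _ _ par).
by apply; rewrite cats0.
Qed.

(** * Complete systems: Newman's induction with weights *)

Section Complete.
Hypotheses (noeth : noetherian R) (confl : confluent R).
Hypothesis overlap_small : forall l r l' r', List.In (l, r) R -> List.In (l', r') R ->
  size (ext phi l) + size (ext phi l') <= j.

Let wf_step : well_founded (fun v u => step R u v).
Proof. exact: noetherian_wf. Qed.

Definition phi_wt_joinable u v v' := exists z k k',
  [/\ wpath (step R) v z k, wpath (step R) v' z k' & phi_wt u v (+) k = phi_wt u v' (+) k'].

Lemma phi_wt_joinable_sym u v v' : phi_wt_joinable u v v' -> phi_wt_joinable u v' v.
Proof. by move=> [z [k [k' [? ? ?]]]]; exists z, k', k. Qed.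

(** Confluence closes the peak within the window t, where both sides weigh as much as the jump from
    t to the common reduct. *)
Lemma overlap_joinable x y t s s' : step R t s -> step R t s' -> size (ext phi t) <= j ->
  phi_wt_joinable (x ++ t ++ y) (x ++ s ++ y) (x ++ s' ++ y).
Proof.
move=> ts ts' small; have [z [sz s'z]] := confl (rt_step _ _ _ _ ts) (rt_step _ _ _ _ ts').
have [cs cs'] : cong R t s /\ cong R t s' by split; apply: rst_step.
have cz := cong_trans cs (rt_step_cong sz).
have size_small s0 : cong R t s0 -> size (ext phi s0) <= j.
  by move=> /phi_cong/Mcong_inv[<-].
have wp s0 : cong R t s0 -> clos_refl_trans _ (step R) s0 z ->
    wpath (step R) (x ++ s0 ++ y) (x ++ z ++ y) (phi_wt (x ++ s0 ++ y) (x ++ z ++ y)).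
  move=> c0 s0z; apply: wpath_window (size_small _ c0) => // [u v|u v].
    exact: step_ctx.
  exact: rst_step.
exists (x ++ z ++ y); do 2!eexists; split; [exact: wp cs sz | exact: wp cs' s'z |].
by rewrite !phi_wt_window.
Qed.

Lemma disjoint_joinable x l1 r1 m l2 r2 y : List.In (l1, r1) R -> List.In (l2, r2) R ->
  nbc (ext phi (x ++ l1 ++ m ++ l2 ++ y)) = 1 ->
  phi_wt_joinable (x ++ l1 ++ m ++ l2 ++ y) (x ++ r1 ++ m ++ l2 ++ y) (x ++ l1 ++ m ++ r2 ++ y).
Proof.
move=> R1 R2 c1; exists (x ++ r1 ++ m ++ r2 ++ y); do 2!eexists; split.
- apply: wpath_cons (wpath_nil _ _).
  by exists (x ++ r1 ++ m), l2, r2, y; rewrite -!catA.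
- apply: wpath_cons (wpath_nil _ _).
  by exists x, l1, r1, (m ++ r2 ++ y).
- by rewrite !addbF; apply: (@phi_wt_disjoint x y m (l1, r1) true (l2, r2) true R1 R2 c1).
Qed.

Lemma local_joinable u v v' : step R u v -> step R u v' ->
  nbc (ext phi u) = 1 -> phi_wt_joinable u v v'.
Proof.
move=> [x1 [l1 [r1 [y1 [R1 [-> ->]]]]]] [x2 [l2 [r2 [y2 [R2 [eqxy ->]]]]]].
(* By symmetry the first redex starts no later than the second. *)
wlog [d -> eqy] : x1 l1 r1 y1 R1 x2 l2 r2 y2 R2 eqxy /
    exists2 d, x2 = x1 ++ d & l1 ++ y1 = d ++ l2 ++ y2.
  move=> IH; have [[d [x2E eqy]]|[d [x1E eqy]]] := cat_eq_cat eqxy.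
    by apply: (IH _ _ _ _ R1 _ _ _ _ R2 eqxy); exists d.
  rewrite eqxy => c1; apply: phi_wt_joinable_sym.
  by apply: (IH _ _ _ _ R2 _ _ _ _ R1 (esym eqxy)) c1; exists d.
have step_at s t z w y : List.In (s, t) R -> z ++ s ++ y = w -> step R w (z ++ t ++ y).
  by move=> st <-; exists z, s, t, y.
have [[m [-> ->]]|[e [l1E eqe]]] := cat_eq_cat eqy.
  by move=> c1; rewrite -!catA; exact: (disjoint_joinable R1 R2 c1).
have step1 y : step R (l1 ++ y) (r1 ++ y) by apply: (step_at l1 r1 [::]).
(* Either [l2] sticks out of [l1] by f and the window is [l1 ++ f], or [l2] lies inside [l1] and the
   window is [l1]. *)
have [[f [l2E y1E]]|[g [eE y2E]]] := cat_eq_cat (esym eqe) => _.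
  have step2 : step R (l1 ++ f) (d ++ r2).
    have := step_at _ _ d (l1 ++ f) [::] R2; rewrite !cats0; apply.
    by rewrite l1E l2E -catA.
  have := overlap_joinable x1 y2 (step1 f) step2; rewrite y1E -!catA; apply.
  apply: leq_trans (overlap_small R1 R2).
  by rewrite l2E !ext_cat !size_cat leq_add2l leq_addl.
have step2 : step R l1 (d ++ r2 ++ g).
  by apply: step_at R2 _; rewrite l1E eE.
have := step1 [::]; rewrite !cats0 => {}step1.
have := overlap_joinable x1 y1 step1 step2; rewrite y2E -!catA; apply.
by apply: leq_trans (overlap_small R1 R2); apply: leq_addr.
Qed.

Definition irreducible_word u := forall v, ~ step R u v.

Lemma normalizes u : exists n k, irreducible_word n /\ wpath (step R) u n k.
Proof.
elim/(well_founded_ind wf_step): u => u IH.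
have [[v uv]|irr] := classic (exists v, step R u v).
  have [n [k [irr vn]]] := IH v uv.
  by exists n, (phi_wt u v (+) k); split=> //; apply: wpath_cons vn.
exists u, false; split; last exact: wpath_nil.
by move=> v uv; apply: irr; exists v.
Qed.

Lemma irreducible_wpath n v k : irreducible_word n -> wpath (step R) n v k ->
  n = v /\ k = false.
Proof. by move=> irr wp; case: wp irr => // u w v' k' uw _ /(_ _ uw). Qed.

(** The two first steps are joined with equal weights at z; both given paths are then compared with
    paths through a normal form of z. *)
Lemma normal_form_weight u n n' k k' : nbc (ext phi u) = 1 ->
  irreducible_word n -> irreducible_word n' ->
  wpath (step R) u n k -> wpath (step R) u n' k' -> n = n' /\ k = k'.
Proof.
elim/(well_founded_ind wf_step): u n n' k k' => u IH n n' k k' c1 irr irr' un un'.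
case: un IH irr c1 un' => {u n k} [u _ irr _ un'|u v n k uv vn IH irr c1 un'].
  by have [-> ->] := irreducible_wpath irr un'.
case: un' uv IH irr' c1 => {u n' k'} [u uv _ irr' _|u v' n' k' uv' vn' uv IH irr' c1].
  by case: (irr' _ uv).
have [z [a [a' [vz v'z eqW]]]] := local_joinable uv uv' c1.
have [m [b [irrm zm]]] := normalizes z.
have c_step w : step R u w -> nbc (ext phi w) = 1.
  by move=> uw; rewrite -c1; have /phi_cong/Mcong_inv[] := rst_step _ _ _ _ uw.
have [nm kE] := IH _ uv _ _ _ _ (c_step _ uv) irr irrm vn (wpath_cat vz zm).
have [nm' kE'] := IH _ uv' _ _ _ _ (c_step _ uv') irr' irrm vn' (wpath_cat v'z zm).
by rewrite nm nm' kE kE' !addbA eqW.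
Qed.

Lemma complete_coherent : phi_wt_coherent.
Proof.
(* The weight of reduction to normal form is a potential: a zigzag weighs the sum mod 2 of the
   potentials at its ends, hence depends only on them. *)
have potential u v k : nbc (ext phi u) = 1 -> wpath zigzag u v k ->
    forall n m a b, irreducible_word n -> irreducible_word m ->
    wpath (step R) u n a -> wpath (step R) v m b -> k = a (+) b.
  move=> + uv; elim: uv => {u v k} [u c1 n m a b irrn irrm un um|].
    by have [_ ->] := normal_form_weight c1 irrn irrm un um; rewrite addbb.
  move=> u v w k uv _ IH c1 n m a b irrn irrm un wm.
  have c1' : nbc (ext phi v) = 1.
    by rewrite -c1; have /phi_cong/Mcong_inv[] := zigzag_cong uv.
  have [n' [a' [irrn' vn']]] := normalizes v.
  rewrite (IH c1' _ _ _ _ irrn' irrm vn' wm) addbA; congr (_ (+) _).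
  case: uv => uv.
    by have [_ ->] := normal_form_weight c1 irrn irrn' un (wpath_cons uv vn').
  have [_ ->] := normal_form_weight c1' irrn' irrn vn' (wpath_cons uv un).
  suff -> : phi_wt u v = phi_wt v u by rewrite addbA addbb.
  by case: uv => x [l [r [y [lr [-> ->]]]]]; rewrite (phi_wt_rule_sym x y lr).
move=> u v k k' c1 uv uv'.
have [n [a [irrn un]]] := normalizes u; have [m [b [irrm vm]]] := normalizes v.
by rewrite (potential _ _ _ c1 uv _ _ _ _ irrn irrm un vm)
  (potential _ _ _ c1 uv' _ _ _ _ irrn irrm un vm).
Qed.

End Complete.
End PresentationWeight.

(** * Choice of j and conclusion *)

Lemma In_bounded (T : Type) (f : T -> nat) (s : seq T) :
  exists K, forall t, List.In t s -> f t <= K.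
Proof.
elim: s => [|t s [K sK]]; first by exists 0.
exists (maxn (f t) K) => t' [<-|/sK]; rewrite leq_max ?leqnn // => ->.
exact: orbT.
Qed.

Lemma not_FDT_Mrel : ~ FDT Mrel.
Proof.
move=> [B [R [[phi [psi [phiP psiP]]] [Hs [Hpar base]]]]].
have [K1 K1P] := In_bounded (fun lr => size (ext phi lr.1)) R.
have [K2 K2P] := In_bounded (fun pq => size (ext phi pq.1.1)) Hs.
have phi_cong u v : cong R u v -> Mcong (ext phi u) (ext phi v) by move/phiP.
(* [K1] makes the rules fit in a window and [K2] the base pairs; 3 is the length of the longest
   defining relation of M. *)
pose j := K1 + K2 + 3.
apply: (@phi_wt_incoherent B R phi j phi_cong psi) => //.
- by move=> u v /phiP.
- by rewrite /j addn3.
apply: homotopy_base_coherent Hpar base _ => //.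
- by move=> l r /K1P /leq_trans; apply; rewrite /j -addnA leq_addr.
- by move=> p q /K2P /leq_trans; apply; rewrite /j addnAC leq_addl.
Qed.

Lemma not_FCRS_Mrel : ~ FCRS Mrel.
Proof.
move=> [B [R [[phi [psi [phiP psiP]]] [noeth confl]]]].
have [K KP] := In_bounded (fun lr => size (ext phi lr.1)) R.
have phi_cong u v : cong R u v -> Mcong (ext phi u) (ext phi v) by move/phiP.
(* [K + K] makes every overlap of two left-hand sides fit in a window. *)
pose j := K + K + 3.
apply: (@phi_wt_incoherent B R phi j phi_cong psi) => //.
- by move=> u v /phiP.
- by rewrite /j addn3.
apply: complete_coherent noeth confl _ => //.
- by move=> l r /KP /leq_trans; apply; rewrite /j -addnA leq_addr.
- move=> l r l' r' /KP /= lK /KP /= l'K; apply: leq_trans (leq_add lK l'K) _.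
  exact: leq_addr.
Qed.

Theorem theorem3p8 :
  (forall w : seq abc, exists! u : seq abc, normal_form u /\ cong Mrel u w) /\
  (biautomatic Mrel /\ automatic Mrel) /\
  (~ FDT Mrel /\ ~ FCRS Mrel).
Proof.
split; first exact: unique_normal_form.
split; first by split; [|apply: biautomatic_automatic]; exact: biautomatic_Mrel.
by split; [exact: not_FDT_Mrel | exact: not_FCRS_Mrel].
Qed.
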